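(* Let $D$ be an Arakelov divisor on $\overline{\operatorname{Spec}{\mathbb Z}}$. Then $$\dim_{\mathbb S} H^0(D)-\dim_{\mathbb S} H^1(D)=\lceil \deg_2 D\rceil'+1,$$ where $\deg_2 D:=\deg(D)/\log 2$ and $\lceil x\rceil'$ is the right continuous function of $x\in{\mathbb R}$ which agrees with $\operatorname{ceiling}(x)$ for non-integer $x>0$ and with $-\operatorname{ceiling}(-x)$ for non-integer $x<0$ (equivalently, $\lceil x\rceil'=\lfloor x\rfloor+1$ for $x\geq 0$ and $\lceil x\rceil'=\lfloor x\rfloor$ for $x<0$).
   Context: An Arakelov divisor on $\overline{\operatorname{Spec}{\mathbb Z}}$ is a formal sum $D=\sum_p a_p\{p\}+a_\infty\{\infty\}$ (finitely many nonzero $a_p\in{\mathbb Z}$, $a_\infty\in{\mathbb R}$), with $\deg D=\sum_p a_p\log p+a_\infty$. Put $\lambda=e^{\deg D}$. $H^0(D)$ is the ${\mathbb S}$-module $(H{\mathbb Z})_I$ with $I=[-\lambda,\lambda]\cap{\mathbb Z}$, where $(H{\mathbb Z})_X(k_+)=\{a\in{\mathbb Z}^k\mid\sum_{j\in Z}a_j\in X\ \forall Z\subset\{1,\dots,k\}\}$; $\dim_{\mathbb S}H^0(D)$ is the smallest cardinality of a subset $G\subset I$ such that for every $x\in I$ there is $Z\subset G$ with $\sum_{g\in Z}g=x$ and $\sum_{g\in Z'}g\in I$ for all $Z'\subset Z$ (so it is $0$ when $I=\{0\}$). $H^1(D)$ is the tolerant ${\mathbb S}$-module $(U(1),d)_\lambda$: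 the ${\mathbb S}$-module $H({\mathbb R}/{\mathbb Z})$ with, at level $1$, the tolerance relation $d(x,y)\leq\lambda$, where $d$ is the canonical metric of length $1$ on ${\mathbb R}/{\mathbb Z}$. $\dim_{\mathbb S}H^1(D)$ is the minimal cardinality of a subset $F\subset{\mathbb R}/{\mathbb Z}$ such that distinct elements of $F$ are at distance $>\lambda$ and every $x\in{\mathbb R}/{\mathbb Z}$ is at distance $\leq\lambda$ from $\sum_{g\in Z}g$ for some $Z\subset F$ (empty sum $=0$). *)

(* Defs.v *)
From HB Require Import structures.
From mathcomp Require Import all_boot all_order all_algebra ring_quotient.
From mathcomp Require Import finmap.
From mathcomp Require Import boolp classical_sets functions cardinality fsbigop.
From mathcomp Require Import reals topology normedtype sequences exp.

Set Implicit Arguments.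
Unset Strict Implicit.
Unset Printing Implicit Defensive.

Import Order.TTheory GRing.Theory Num.Theory.
Import numFieldNormedType.Exports.
Local Open Scope classical_set_scope.
Local Open Scope ring_scope.
Local Open Scope quotient_scope.
Local Open Scope card_scope.

(* A pointed map k_+ -> l_+, given by its restriction to {1, ..., k}; [None] is
   the base point of l_+. *)
Definition pmap (k l : nat) := 'I_k -> option 'I_l.

Definition pmap_id k : pmap k k := fun i => Some i.

Definition pmap_comp k l m (g : pmap l m) (f : pmap k l) : pmap k m :=
  fun i => obind g (f i).

(* The map k_+ -> 1_+ sending i to 1 and everything else to the base point. *)
Definition pmap_proj k (i : 'I_k) : pmap k 1 :=
  fun j => if j == i then Some ord0 else None.

Definition pmap_fold k : pmap k 1 := fun=> Some ord0.

(* S-modules (Gamma-sets): functors from finite pointed sets to pointed sets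
   that preserve the zero object. *)
Record smodule := SModule {
  level :> nat -> Type;
  base : forall k, level k;
  act : forall k l, pmap k l -> level k -> level l;
  level0 : forall x : level 0, x = base 0;
  act_base : forall k l (f : pmap k l), act f (base k) = base l;
  act_id : forall k (x : level k), act (@pmap_id k) x = x;
  act_comp : forall k l m (g : pmap l m) (f : pmap k l) (x : level k),
    act (pmap_comp g f) x = act g (act f x)
}.

Section EilenbergMacLane.
Variable A : zmodType.

Definition push k l (f : pmap k l) (a : {ffun 'I_k -> A}) : {ffun 'I_l -> A} :=
  [ffun j => \sum_(i | f i == Some j) a i].

Lemma push0 k l (f : pmap k l) : push f [ffun=> 0] = [ffun=> 0].
Proof. by apply/ffunP => j; rewrite !ffunE big1 // => i _; rewrite ffunE. Qed.

Lemma push_id k (a : {ffun 'I_k -> A}) : push (@pmap_id k) a = a.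
Proof.
apply/ffunP => j; rewrite ffunE; under eq_bigl do rewrite /pmap_id.
by rewrite (big_pred1 j) // => i; rewrite (inj_eq (@Some_inj _)).
Qed.

Lemma push_comp k l m (g : pmap l m) (f : pmap k l) (a : {ffun 'I_k -> A}) :
  push (pmap_comp g f) a = push g (push f a).
Proof.
apply/ffunP => h; rewrite !ffunE.
under [RHS]eq_bigr do rewrite ffunE.
rewrite (exchange_big_dep (fun i => pmap_comp g f i == Some h)) /=; last first.
  by move=> j i gj /eqP fi; rewrite /pmap_comp fi.
apply: eq_bigr => i; rewrite /pmap_comp; case fi: (f i) => [j0|//] /= gj0.
rewrite (big_pred1 j0) // => j /=; rewrite (inj_eq (@Some_inj _)) (eq_sym j0).
by case: (j =P j0) => [->|_]; rewrite ?gj0 ?andbF.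
Qed.

Lemma ffun0_uniq (a : {ffun 'I_0 -> A}) : a = [ffun=> 0].
Proof. by apply/ffunP => -[]. Qed.

Definition EM : smodule :=
  @SModule (fun k => {ffun 'I_k -> A}) (fun k => [ffun=> 0]) push
    ffun0_uniq push0 push_id push_comp.

Variables (X : {pred A}) (X0 : 0 \in X).

Definition subsums_in k (a : {ffun 'I_k -> A}) : bool :=
  [forall Z : {set 'I_k}, \sum_(j in Z) a j \in X].

Lemma subsums_in0 k : subsums_in ([ffun=> 0] : {ffun 'I_k -> A}).
Proof. by apply/forallP => Z; rewrite big1 // => j _; rewrite ffunE. Qed.

Lemma subsums_in_push k l (f : pmap k l) (a : {ffun 'I_k -> A}) :
  subsums_in a -> subsums_in (push f a).
Proof.
move/forallP => aX; apply/forallP => Z.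
rewrite (_ : \sum_(j in Z) _ =
   \sum_(i in [set i | if f i is Some j then j \in Z else false]%SET) a i) //.
under eq_bigr do rewrite ffunE.
rewrite (exchange_big_dep
  (mem [set i | if f i is Some j then j \in Z else false]%SET)) /=; last first.
  by move=> j i jZ /eqP fi; rewrite inE fi.
apply: eq_bigr => i; rewrite inE; case fi: (f i) => [j0|//] /= j0Z.
rewrite (big_pred1 j0) // => j /=; rewrite (inj_eq (@Some_inj _)) (eq_sym j0).
by case: (j =P j0) => [->|_]; rewrite ?j0Z ?andbF.
Qed.

Definition EMsub_level k := {a : {ffun 'I_k -> A} | subsums_in a}.

Definition EMsub_act k l (f : pmap k l) (a : EMsub_level k) : EMsub_level l :=
  exist _ (push f (val a)) (subsums_in_push f (valP a)).

Definition EMsub_base k : EMsub_level k := exist _ [ffun=> 0] (subsums_in0 k).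

Lemma EMsub_level0 (a : EMsub_level 0) : a = EMsub_base 0.
Proof. by apply: val_inj; exact: ffun0_uniq. Qed.

Lemma EMsub_act0 k l (f : pmap k l) :
  EMsub_act f (EMsub_base k) = EMsub_base l.
Proof. by apply: val_inj; exact: push0. Qed.

Lemma EMsub_act_id k (a : EMsub_level k) : EMsub_act (@pmap_id k) a = a.
Proof. by apply: val_inj; exact: push_id. Qed.

Lemma EMsub_act_comp k l m (g : pmap l m) (f : pmap k l) (a : EMsub_level k) :
  EMsub_act (pmap_comp g f) a = EMsub_act g (EMsub_act f a).
Proof. by apply: val_inj; exact: push_comp. Qed.

(* The sub-S-module (HA)_X of HA. *)
Definition EMsub : smodule :=
  @SModule EMsub_level EMsub_base EMsub_act
    EMsub_level0 EMsub_act0 EMsub_act_id EMsub_act_comp.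

End EilenbergMacLane.

(* Only the tolerance relation at level 1 enters the dimension. *)
Record tsmodule := TSModule {
  tsmod :> smodule;
  tol : tsmod 1 -> tsmod 1 -> Prop;
  tol_refl : forall x, tol x x;
  tol_sym : forall x y, tol x y -> tol y x
}.

Definition discrete (E : smodule) : tsmodule :=
  @TSModule E eq (@erefl _) (@esym _).

(* y is a sum of e_1, ..., e_k in E: some z in E(k_+) has components e_i and
   is mapped to y by the fold map k_+ -> 1_+. *)
Definition is_sum (E : smodule) k (e : 'I_k -> E 1) (y : E 1) : Prop :=
  exists z : E k, (forall i, act (pmap_proj i) z = e i) /\
                  act (@pmap_fold k) z = y.

(* A finite subset Z of F is given by an injective enumeration e of it. *)
Definition generates (E : tsmodule) (F : set (E 1)) : Prop :=
  (forall x y, F x -> F y -> x <> y -> ~ tol x y) /\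
  (forall x, exists k (e : 'I_k -> E 1) (y : E 1),
     [/\ injective e, forall i, F (e i), is_sum e y & tol x y]).

Definition least_card T (P : set T -> Prop) (n : nat) : Prop :=
  (exists F, P F /\ F #= `I_n) /\
  (forall m F, P F -> F #= `I_m -> (n <= m)%N).

Definition is_dimS (E : tsmodule) (n : nat) : Prop :=
  least_card (@generates E) n.

Section Circle.
Variable R : realType.

Definition integers : {pred R} := fun x => x \is a Num.int.

Lemma integers_zmod_closed : zmod_closed integers.
Proof. by split=> [|x y]; [exact: rpred0|exact: rpredB]. Qed.

HB.instance Definition _ :=
  GRing.isZmodClosed.Build R integers integers_zmod_closed.

Definition RmodZ : Type := @Quotient.quot R integers.

HB.instance Definition _ := GRing.Zmodule.on RmodZ.
HB.instance Definition _ := Quotient.on RmodZ.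

Definition circ_dist (x y : RmodZ) : R :=
  inf [set `|a - b| | a in [set a | \pi_(RmodZ) a = x]
                    & b in [set b | \pi_(RmodZ) b = y]].

Lemma circ_dist_sym x y : circ_dist x y = circ_dist y x.
Proof.
rewrite /circ_dist; congr inf; apply/seteqP; split=> r [a ax [b bY <-]];
  by exists b => //; exists a => //; rewrite distrC.
Qed.

Lemma circ_dist_xx x : circ_dist x x = 0.
Proof.
apply/eqP; rewrite eq_le; apply/andP; split.
  apply: ge_inf; first by exists 0 => _ [a _ [b _ <-]].
  by exists (repr x); [exact: reprK|exists (repr x); rewrite ?subrr ?normr0 //=;
    exact: reprK].
apply: lb_le_inf => [|_ [a _ [b _ <-]] //].
by exists `|repr x - repr x|, (repr x); [exact: reprK|exists (repr x) => //;
  exact: reprK].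
Qed.

Section Tolerance.
Variables (lambda : R) (lambda0 : 0 <= lambda).

Definition circ_tol (x y : EM RmodZ 1) : Prop :=
  circ_dist (x ord0) (y ord0) <= lambda.

Lemma circ_tol_refl x : circ_tol x x.
Proof. by rewrite /circ_tol circ_dist_xx. Qed.

Lemma circ_tol_sym x y : circ_tol x y -> circ_tol y x.
Proof. by rewrite /circ_tol circ_dist_sym. Qed.

(* (U(1), d)_lambda *)
Definition U1 : tsmodule :=
  @TSModule (EM RmodZ) circ_tol circ_tol_refl circ_tol_sym.

End Tolerance.
End Circle.

Record arakelov_divisor (R : realType) := ArakelovDivisor {
  fin_coef : {p : nat | prime p} -> int;
  fin_coef_finite : finite_set [set p | fin_coef p != 0];
  inf_coef : R
}.

Section Cohomology.
Variables (R : realType) (D : arakelov_divisor R).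

Definition deg : R :=
  (\sum_(p \in [set: {p : nat | prime p}])
      (fin_coef D p)%:~R * ln ((val p)%:R : R)) + inf_coef D.

Definition deg2 : R := deg / ln 2.

Definition lambda : R := expR deg.

Lemma lambda_ge0 : 0 <= lambda. Proof. exact: expR_ge0. Qed.

Definition int_itv : {pred int} := fun n => - lambda <= n%:~R <= lambda.

Lemma int_itv0 : 0 \in int_itv.
Proof. by rewrite unfold_in oppr_le0 lambda_ge0. Qed.

Definition H0 : tsmodule := discrete (EMsub int_itv0).

Definition H1 : tsmodule := U1 lambda_ge0.

End Cohomology.

Definition ceil' (R : realType) (x : R) : int :=
  if 0 <= x then Num.floor x + 1 else Num.floor x.
Section ExplicitSums.
Variable A : zmodType.

Lemma push_proj k (i : 'I_k) (a : {ffun 'I_k -> A}) :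
  push (pmap_proj i) a = [ffun=> a i].
Proof.
apply/ffunP => j; rewrite !ffunE (big_pred1 i) // => h.
by rewrite /pmap_proj (ord1 j) /=; case: (h == i).
Qed.

Lemma push_fold k (a : {ffun 'I_k -> A}) :
  push (@pmap_fold k) a = [ffun=> \sum_i a i].
Proof.
apply/ffunP => j; rewrite !ffunE; apply: eq_bigl => h.
by rewrite /pmap_fold (ord1 j) eqxx.
Qed.

Lemma sum_fset_enum k (e : 'I_k -> A) (Y : {fset A}) : injective e ->
  (forall y, y \in Y -> exists i, y = e i) ->
  \sum_(g <- Y) g = \sum_(i | e i \in Y) e i.
Proof.
move=> e_inj Ye; rewrite -[RHS]big_filter -(big_map e predT id).
apply: perm_big; apply: uniq_perm; first exact: fset_uniq.
  by rewrite map_inj_uniq // filter_uniq // index_enum_uniq.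
move=> y; apply/idP/mapP => [yY|[i]]; last by rewrite mem_filter => /andP[? _] ->.
by have [i yi] := Ye _ yY; exists i => //; rewrite mem_filter -yi yY mem_index_enum.
Qed.

Lemma enum_fsetP (X : {pred A}) (G : set A) (y : A) :
  (exists k (e : {ffun 'I_k -> A}),
     [/\ injective e, forall i, G (e i), \sum_i e i = y & subsums_in X e]) <->
  (exists Z : {fset A},
     [/\ [set` Z] `<=` G, \sum_(g <- Z) g = y
       & forall Z' : {fset A}, (Z' `<=` Z)%fset -> \sum_(g <- Z') g \in X]).
Proof.
split=> [[k [e [e_inj eG <- /forallP eX]]]|[Z [ZG <- ZX]]].
  pose Z := [fset e i | i in 'I_k]%fset.
  have ZE x : x \in Z -> exists i, x = e i by case/imfsetP => i _ ->; exists i.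
  exists Z; split=> [x /= /ZE[i ->] //||Z' /fsubsetP ZZ'].
    rewrite (sum_fset_enum e_inj ZE); apply: eq_bigl => i.
    by rewrite in_imfset.
  rewrite (@sum_fset_enum _ e) // => [|x /ZZ' /ZE //].
  have := eX [set i | e i \in Z']%SET.
  by under eq_bigl do rewrite inE.
pose e : {ffun 'I_#|` Z| -> A} := [ffun i : 'I_#|` Z| => nth 0 Z i].
have eE i : e i = nth 0 Z i by rewrite ffunE.
have e_inj : injective e.
  move=> i j; rewrite !eE => /eqP; rewrite nth_uniq ?fset_uniq //.
  by move/eqP/val_inj.
have eZ i : e i \in Z by rewrite eE mem_nth.
have ZE x : x \in Z -> exists i, x = e i.
  move=> xZ; have xs : (index x Z < #|` Z|)%N by rewrite index_mem.
  by exists (Ordinal xs); rewrite eE /= nth_index.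
exists #|` Z|, e; split=> // [i||]; first exact/ZG/eZ.
  by rewrite (sum_fset_enum e_inj ZE); apply: eq_bigl => i; rewrite eZ.
apply/forallP => T.
pose Y := [fset e i | i in T]%fset.
have YZ : (Y `<=` Z)%fset by apply/fsubsetP => x /imfsetP[i _ ->].
have := ZX _ YZ; rewrite (sum_fset_enum e_inj); last first.
  by move=> x /imfsetP[i _ ->]; exists i.
under eq_bigl => i.
  by rewrite (_ : (e i \in Y) = (i \in T)); first over; rewrite mem_imfset.
by [].
Qed.

End ExplicitSums.

Lemma least_card_iso (T U : Type) (P : set T -> Prop) (Q : set U -> Prop)
    (phi : T -> U) n : injective phi ->
  (forall F, P F -> Q (phi @` F)) ->
  (forall G, Q G -> G `<=` range phi /\ P (phi @^-1` G)) ->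
  least_card P n <-> least_card Q n.
Proof.
move=> phi_inj PQ QP.
have cardF (F : set T) m : F #= `I_m -> phi @` F #= `I_m.
  by move=> Fm; apply: card_eq_trans Fm; apply: inj_card_eq; exact: in2W.
have cardG (G : set U) m : Q G -> G #= `I_m -> phi @^-1` G #= `I_m.
  move=> /QP[Gr _] Gm; have GE : phi @` (phi @^-1` G) = G.
    apply/seteqP; split=> [_ [t Gt <-] //|u Gu].
    by have [t _ tu] := Gr _ Gu; exists t => //=; rewrite tu.
  apply: (card_eq_trans _ Gm); rewrite card_eq_sym -[X in X #= _]GE.
  by apply: inj_card_eq; exact: in2W.
split=> -[[F [PF Fn]] min]; split.
- by exists (phi @` F); split; [exact: PQ|exact: cardF].
- by move=> m G QG Gm; apply: (min m (phi @^-1` G)); [case: (QP _ QG)|exact: cardG].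
- by exists (phi @^-1` F); split; [case: (QP _ PF)|exact: cardG].
- by move=> m G PG Gm; apply: (min m (phi @` G)); [exact: PQ|exact: cardF].
Qed.

Lemma is_dimS_EMsubP (A : zmodType) (X : {pred A}) (X0 : 0 \in X) n :
  is_dimS (discrete (EMsub X0)) n <->
  least_card (fun G : set A => G `<=` [set` X] /\
    forall x, x \in X -> exists Z : {fset A},
      [/\ [set` Z] `<=` G, \sum_(g <- Z) g = x
        & forall Z' : {fset A}, (Z' `<=` Z)%fset -> \sum_(g <- Z') g \in X]) n.
Proof.
have single x : x \in X -> subsums_in X ([ffun=> x] : {ffun 'I_1 -> A}).
  move=> xX; apply/forallP => Z; case: (boolP (ord0 \in Z)) => oZ.
    rewrite (big_pred1 ord0) ?ffunE // => i.
    by rewrite (ord1 i) oZ.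
  by rewrite big_pred0 // => i; rewrite (ord1 i); exact: negbTE.
pose mk x (xX : x \in X) : EMsub X0 1 := exist _ [ffun=> x] (single x xX).
pose phi (a : EMsub X0 1) : A := val a ord0.
have phi_inj : injective phi.
  by move=> a b ab; apply: val_inj; apply/ffunP => i; rewrite (ord1 i).
have phiX a : phi a \in X.
  have /forallP/(_ [set ord0]%SET) := valP a.
  by rewrite big_set1.
have phi_sum k (e : 'I_k -> EMsub X0 1) y : is_sum e y <->
    \sum_i phi (e i) = phi y /\ subsums_in X [ffun i => phi (e i)].
  split=> [[z [ze zy]]|[ey eX]].
    have zE i : phi (e i) = val z i by rewrite -ze /phi /= push_proj ffunE.
    split; first by rewrite -zy /phi /= push_fold ffunE; apply: eq_bigr => i _; exact: zE.
    by rewrite (_ : finfun _ = val z) ?(valP z) //; apply/ffunP => i; rewrite ffunE zE.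
  exists (exist _ [ffun i => phi (e i)] eX); split=> [i|]; apply: phi_inj.
    by rewrite /phi /= push_proj !ffunE.
  by rewrite /phi /= push_fold ffunE -[RHS]ey; apply: eq_bigr => i _; rewrite ffunE.
apply: (@least_card_iso _ _ _ _ phi) => // [F [_ Fgen]|G [GX Ggen]].
  split=> [_ [a _ <-] /=|x xX]; first exact: phiX.
  have [k [e [y [e_inj eF /phi_sum[ey eX] xy]]]] := Fgen (mk x xX).
  apply/enum_fsetP; exists k, [ffun i => phi (e i)]; split=> //.
  - by move=> i j; rewrite !ffunE => /phi_inj/e_inj.
  - by move=> i; rewrite ffunE; exists (e i).
  - by under eq_bigr do rewrite ffunE; rewrite ey -xy /phi /= ffunE.
split=> [g /GX gX|].
  by exists (mk g gX) => //; rewrite /phi /= ffunE.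
split=> // x; have /enum_fsetP[k [e [e_inj eG ex eX]]] := Ggen _ (phiX x).
have eiX i : e i \in X by exact/GX/eG.
have phie i : phi (mk _ (eiX i)) = e i by rewrite /phi /= ffunE.
exists k, (fun i => mk _ (eiX i)), x; split=> //.
- by move=> i j /(congr1 phi); rewrite !phie => /e_inj.
- by move=> i; rewrite /= phie; exact: eG.
- apply/phi_sum; split; first by under eq_bigr do rewrite phie.
  by rewrite (_ : finfun _ = e) //; apply/ffunP => i; rewrite ffunE phie.
Qed.

Lemma is_dimS_U1P (R : realType) (l : R) (l0 : 0 <= l) n :
  is_dimS (U1 l0) n <->
  least_card (fun F : set (RmodZ R) =>
    (forall x y, F x -> F y -> x <> y -> l < circ_dist x y) /\
    forall x, exists Z : {fset RmodZ R},
      [set` Z] `<=` F /\ circ_dist x (\sum_(g <- Z) g) <= l) n.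
Proof.
pose mk (x : RmodZ R) : U1 l0 1 := [ffun=> x].
pose phi (a : U1 l0 1) : RmodZ R := a ord0.
have phiK : cancel phi mk.
  by move=> a; apply/ffunP => i; rewrite ffunE (ord1 i).
have mkK : cancel mk phi by move=> x; rewrite /phi ffunE.
have phi_inj := can_inj phiK.
have phi_sum k (e : 'I_k -> U1 l0 1) y : is_sum (E := U1 l0) e y <->
    \sum_i phi (e i) = phi y.
  split=> [[z [ze zy]]|ey].
    rewrite -zy /phi /= push_fold ffunE; apply: eq_bigr => i _.
    by rewrite -ze /= push_proj ffunE.
  exists ([ffun i => phi (e i)] : {ffun 'I_k -> RmodZ R}); split=> [i|];
    apply: phi_inj.
    by rewrite /phi /= push_proj !ffunE.
  by rewrite /phi /= push_fold ffunE -[RHS]ey; apply: eq_bigr => i _; rewrite ffunE.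
have allT k (e : {ffun 'I_k -> RmodZ R}) : subsums_in predT e by exact/forallP.
apply: (@least_card_iso _ _ _ _ phi) => // [F [Fsep Fgen]|G [Gsep Ggen]].
  split=> [_ _ [a Fa <-] [b Fb <-] ab|x].
    have {}ab : a <> b by move=> E; apply: ab; rewrite E.
    by have /negP := Fsep _ _ Fa Fb ab; rewrite -ltNge.
  have [k [e [y [e_inj eF /phi_sum ey xy]]]] := Fgen (mk x).
  have /enum_fsetP[Z [ZF Zy _]] : exists k (e : {ffun 'I_k -> RmodZ R}),
      [/\ injective e, forall i, (phi @` F) (e i), \sum_i e i = phi y
        & subsums_in predT e].
    exists k, [ffun i => phi (e i)]; split=> //.
    - by move=> i j; rewrite !ffunE => /phi_inj/e_inj.
    - by move=> i; rewrite ffunE; exists (e i).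
    - by under eq_bigr do rewrite ffunE.
  by exists Z; split=> //; rewrite Zy; move: xy; rewrite /= /circ_tol ffunE.
split=> [g _|]; first by exists (mk g).
split=> [x y Gx Gy xy|x].
  have {}xy : phi x <> phi y by move=> /phi_inj.
  by apply/negP; rewrite -ltNge; exact: Gsep.
have [Z [ZG Zx]] := Ggen (phi x).
have /enum_fsetP[k [e [e_inj eG ex _]]] : exists Z' : {fset RmodZ R},
    [/\ [set` Z'] `<=` G, \sum_(g <- Z') g = \sum_(g <- Z) g
      & forall Z'' : {fset RmodZ R}, (Z'' `<=` Z')%fset ->
          \sum_(g <- Z'') g \in predT] by exists Z.
exists k, (fun i => mk (e i)), (mk (\sum_(g <- Z) g)); split=> //.
- by move=> i j /(congr1 phi); rewrite !mkK => /e_inj.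
- by move=> i; rewrite /= mkK; exact: eG.
- by apply/phi_sum; rewrite mkK -ex; apply: eq_bigr => i _; rewrite mkK.
- by rewrite /= /circ_tol -/(phi _) -/(phi (mk _)) mkK.
Qed.

Section CeilPrime.
Variable R : realType.
Implicit Type x : R.

Lemma ceil'_pos x : x \isn't a Num.int -> 0 < x -> ceil' x = Num.ceil x.
Proof.
by move=> xZ x0; rewrite /ceil' (ltW x0) ceil_floor xZ.
Qed.

Lemma ceil'_neg x : x \isn't a Num.int -> x < 0 -> ceil' x = - Num.ceil (- x).
Proof. by move=> xZ x0; rewrite /ceil' leNgt x0 /= floorNceil. Qed.

Lemma ceil'_right_continuous x :
  ((ceil' y)%:~R : R) @[y --> x^'+] --> ((ceil' x)%:~R : R).
Proof.
apply: cvg_near_cst; near=> y.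
have xy : x < y by near: y; exact: nbhs_right_gt.
have yf : y < (Num.floor x + 1)%:~R.
  by near: y; apply: nbhs_right_lt; exact: floorD1_gt.
have fE : Num.floor y = Num.floor x.
  apply: floor_def; rewrite yf andbT.
  exact: le_trans (floor_le _) (ltW xy).
rewrite /ceil' fE; congr (_%:~R); case: ifPn => y0; case: ifPn => x0 //.
  have : 0 <= Num.floor x by rewrite -fE floor_ge0.
  by rewrite floor_ge0 (negbTE x0).
by rewrite (le_trans x0 (ltW xy)) in y0.
Unshelve. all: by end_near. Qed.

End CeilPrime.

(* Main.v *)
(* Write lambda = e^(deg D) = 2^(deg_2 D).  Counting subset sums, n generators
   of [-N, N] force 2^n >= 2 N + 1, and for 2^k <= N < 2^(k+1) the k + 2
   elements 1, 2, ..., 2^k, -N suffice, since a negative x is -N + (N + x) with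
   N + x written in binary.  On the circle, the closed arcs of radius lambda
   around the 2^n subset sums of n generators have to cover total length 1,
   hence 2^(n+1) lambda >= 1; for 2^-(p+1) <= lambda < 2^-p the p classes of
   2^i / 2^p, i < p, are pairwise more than lambda apart and their subset sums
   are all the multiples of 2^-p.  According to the sign of deg_2 D, one of the
   two dimensions vanishes. *)
Require Import Defs.
From mathcomp Require Import all_boot all_order all_algebra ring_quotient.
From mathcomp Require Import finmap boolp classical_sets cardinality.
From mathcomp Require Import reals exp zify lra ring.

Set Implicit Arguments.
Unset Strict Implicit.
Unset Printing Implicit Defensive.

Import Order.TTheory GRing.Theory Num.Theory.
Local Open Scope classical_set_scope.
Local Open Scope ring_scope.
Local Open Scope quotient_scope.
Local Open Scope card_scope.

(** * Integer multiples, binary digits and subset sums *)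

(** A nonzero multiple of [K] is too large to cancel [x]; this separates residues modulo [K]. *)
Lemma small_multiple_eq0 (x c K : int) : `|x| < K -> x + c * K = 0 -> x = 0.
Proof.
move=> xK; case: (ltgtP c 0) => [c0|c0|->]; last by rewrite mul0r addr0.
  have : c * K <= - K by rewrite -mulN1r ler_wpM2r; lia.
  by move: (c * K) => e; lia.
have : K <= c * K by rewrite ler_peMl; lia.
by move: (c * K) => e; lia.
Qed.

Lemma binary_expansion n c : (c < 2 ^ n)%N ->
  exists B : {set 'I_n}, c = (\sum_(i in B) 2 ^ i)%N.
Proof.
elim: n c => [|n IH] c cn.
  exists finset.set0; rewrite big_set0; move: cn; rewrite expn0; lia.
have [B c2] := IH c./2 ltac:(move: cn; rewrite expnS; lia).
(* The digits of [c./2] move up one place; [ord0] is left free for the parity of [c]. *)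
pose C := [set lift ord0 i | i in B]%SET.
have C0 : ord0 \notin C.
  by apply/imsetP => -[i _] /(congr1 val).
have CE : (\sum_(i in C) 2 ^ i = c./2.*2)%N.
  rewrite big_imset /=; last by move=> i j _ _; exact: lift_inj.
  rewrite c2 -muln2 big_distrl /=; apply: eq_bigr => i _.
  by rewrite /bump leq0n add1n expnSr.
rewrite -[c]odd_double_half; case: (odd c); last by exists C; rewrite add0n CE.
by exists (ord0 |: C)%SET; rewrite big_setU1 //= CE expn0.
Qed.

Lemma sum_imfset (A : zmodType) k (e : 'I_k -> A) (B : {set 'I_k}) :
  injective e -> \sum_(g <- [fset e i | i in B]%fset) g = \sum_(i in B) e i.
Proof.
move=> e_inj; rewrite (sum_fset_enum e_inj) => [|y /imfsetP[i _ ->]]; last first.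
  by exists i.
by apply: eq_bigl => i; rewrite mem_imfset.
Qed.

(** Sums are listed once per subset, repetitions included, hence the exact length. Both lower bounds
    on the number of generators count against this list. *)
Lemma subset_sums_seq (A : zmodType) (F : set A) n : F #= `I_n ->
  exists2 S : seq A, size S = (2 ^ n)%N &
    forall Z : {fset A}, [set` Z] `<=` F -> \sum_(g <- Z) g \in S.
Proof.
move=> Fn; have Ffin : finite_set F by exists n.
exists [seq \sum_(g <- Z) g | Z : {fset A} <- fpowerset (fset_set F)].
  by rewrite size_map card_fpowerset (card_fset_set Fn).
move=> Z ZF; apply/mapP; exists Z => //; rewrite fpowersetE.
by apply/fsubsetP => g gZ; rewrite in_fset_set // inE; exact: ZF.
Qed.

(** * Distance on the circle and the dimension of [U1] *)

Section Circle.
Variable R : realType.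
Implicit Types (a b l : R) (x y : RmodZ R).

Lemma pi_RmodZ_eqP a b :
  (\pi_(RmodZ R) a = \pi_(RmodZ R) b) <-> a - b \is a Num.int.
Proof.
have -> : (a - b \is a Num.int) = (\pi_(RmodZ R) a == \pi_(RmodZ R) b).
  exact: (Quotient.idealrBE (@integers R) a b).
by split=> /eqP.
Qed.

Lemma pi_RmodZ_sum (I : Type) (r : seq I) (P : pred I) (f : I -> R) :
  \pi_(RmodZ R) (\sum_(i <- r | P i) f i) =
  \sum_(i <- r | P i) \pi_(RmodZ R) (f i).
Proof.
exact: (raddf_sum (\pi_(@Quotient.quot R (@integers R)))).
Qed.

Lemma circ_dist_le a b : circ_dist (\pi_(RmodZ R) a) (\pi_(RmodZ R) b) <= `|a - b|.
Proof.
apply: ge_inf; first by exists 0 => _ [? _ [? _ <-]].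
by exists a => //; exists b.
Qed.

(** Other representatives change [a - b] only by an integer, so the infimum runs over these
    values. *)
Lemma circ_dist_ge l a b : (forall m : int, l <= `|a - b + m%:~R|) ->
  l <= circ_dist (\pi_(RmodZ R) a) (\pi_(RmodZ R) b).
Proof.
move=> lab; apply: lb_le_inf.
  by exists `|a - b|, a => //; exists b.
move=> _ [c /= /pi_RmodZ_eqP/intrP[m mE] [d /= /pi_RmodZ_eqP/intrP[n nE] <-]].
have -> : c - d = a - b + (m - n)%:~R by rewrite rmorphB /= -mE -nE; ring.
exact: lab.
Qed.

Lemma circ_dist_ge0 x y : 0 <= circ_dist x y.
Proof. by rewrite -[x]reprK -[y]reprK; apply: circ_dist_ge => m. Qed.

Lemma circ_dist_lt_ex l a b :
  circ_dist (\pi_(RmodZ R) a) (\pi_(RmodZ R) b) < l ->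
  exists m : int, `|a - b + m%:~R| < l.
Proof.
move=> ab; apply: contrapT => /forallNP nex; move: ab; apply/negP; rewrite -leNgt.
by apply: circ_dist_ge => m; rewrite leNgt; apply/negP/nex.
Qed.

(* Among the K = M q points j / K, where M = size S and 2 l M q < q - 1, each
   arc contains at most q - 1, so the M arcs cannot contain all of them. *)
Lemma arcs_cover_ge1 l (S : seq (RmodZ R)) :
  (forall x, exists2 s, s \in S & circ_dist x s < l) ->
  1 <= 2 * l * (size S)%:R.
Proof.
move=> cov; rewrite leNgt; apply/negP => lS.
set M := size S in lS.
have l0 : 0 < l.
  by have [s _] := cov 0; apply: le_lt_trans; exact: circ_dist_ge0.
have M0 : (0 < M)%N by rewrite /M; have [s] := cov 0; case: (S).
set d := 1 - 2 * l * M%:R.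
have d0 : 0 < d by rewrite subr_gt0.
pose q := (Num.bound (d^-1)).+1.
have qd : 1 < q%:R * d.
  rewrite -ltr_pdivrMr // div1r; apply: (lt_trans (archi_boundP _)); last first.
    by rewrite ltr_nat.
  by rewrite invr_ge0 ltW.
(* K and rp are kept opaque: ring and field would otherwise unfold them. *)
have [K KE] : exists K, K = (M * q)%N by eexists.
have [rp rpK] : exists rp : RmodZ R -> R, forall x, \pi_(RmodZ R) (rp x) = x.
  by exists repr; exact: reprK.
have K0 : (0 : R) < K%:R by rewrite KE ltr0n muln_gt0 M0.
have LK : 2 * (l * K%:R) < (q.-1)%:R :> R.
  rewrite -subn1 natrB // KE natrM; move: qd; rewrite /d; nra.
have pt (j : nat) : exists sm : RmodZ R * int, sm.1 \in S /\
    `|j%:R - K%:R * rp sm.1 + (sm.2 * K%:Z)%:~R| < l * K%:R.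
  have [s sS] := cov (\pi_(RmodZ R) (j%:R / K%:R)).
  rewrite -{1}[s]rpK => /circ_dist_lt_ex[m ml]; exists (s, m); split=> //=.
  rewrite -ltr_pdivrMr //; congr (_ < _): ml.
  rewrite -[X in _ = _ / X]gtr0_norm // -normf_div; congr `|_|.
  by rewrite rmorphM /=; field; rewrite gt_eqF.
have [f fP] := choice pt.
(* [u j] is the position of point [j] in its arc, measured from the left end in units of [1 / K].
   The arc is shorter than [q - 1] units, so truncation takes at most [q - 1] values. *)
pose u j := j%:R - K%:R * rp (f j).1 + ((f j).2 * K%:Z)%:~R + l * K%:R.
have u_itv j : 0 <= u j < (q.-1)%:R.
  have [_] := fP j; rewrite ltr_norml /u => /andP[]; move: LK; lra.
pose g j := ((f j).1, Num.truncn (u j)).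
have g_inj : {in iota 0 K &, injective g}.
  move=> i j; rewrite !mem_iota /= !add0n => iK jK [fij].
  have /andP[ui0 _] := u_itv i; have /andP[uj0 _] := u_itv j.
  have /andP[] := truncn_itv ui0; have /andP[] := truncn_itv uj0.
  move=> + + + + tE; rewrite tE -addn1 natrD => uj1 uj2 ui1 ui2.
  have uij : `|u i - u j| < 1 by rewrite ltr_norml; apply/andP; split; lra.
  (* In a common arc the real terms cancel, leaving an integer congruent to [i - j] modulo [K];
     having absolute value below 1, it vanishes. *)
  have uE : u i - u j = (i%:Z - j%:Z + ((f i).2 - (f j).2) * K%:Z)%:~R.
    by rewrite /u fij !(rmorphD, rmorphM, rmorphN) /=; ring.
  move: uij; rewrite uE -intr_norm (ltr_int _ _ 1) => ijE.
  move: ((f i).2 - (f j).2) ijE => c ijE.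
  have ij0 : i%:Z - j%:Z + c * K%:Z = 0 by move: (c * K%:Z) ijE => e; lia.
  by have := small_multiple_eq0 _ ij0; lia.
have sub : {subset map g (iota 0 K) <= [seq (s, v) | s <- S, v <- iota 0 q.-1]}.
  move=> _ /mapP[j _ ->]; have [sS _] := fP j.
  apply: allpairs_f => //; rewrite mem_iota /= add0n.
  have /andP[u0 uq] := u_itv j.
  by rewrite -(ltr_nat R); apply: le_lt_trans uq; rewrite truncn_le.
have := uniq_leq_size _ sub; rewrite map_inj_in_uniq // iota_uniq => /(_ isT).
rewrite size_map size_allpairs !size_iota KE -/M /= leq_mul2l.
by rewrite gtn_eqF //= ltnn.
Qed.

(** The upper bound is asked only for [0 < p], so that [p = 0] covers every [l >= 1/2], where the
    arc around 0 is the whole circle. *)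
Lemma dimS_U1 p l (l0 : 0 <= l) : 2^-1 <= 2 ^+ p * l ->
  ((0 < p)%N -> 2 ^+ p * l < 1) -> is_dimS (U1 l0) p.
Proof.
move=> pl lp; apply/is_dimS_U1P.
have P0 : (0 : R) < 2 ^+ p by rewrite exprn_gt0.
pose r i : R := 2 ^+ i / 2 ^+ p.
pose e i := \pi_(RmodZ R) (r i).
(* [2 ^ i - 2 ^ j] is no multiple of [2 ^ p], so the classes are at least [2 ^- p] apart, which
   exceeds [l]. *)
have sep i j : (i < j)%N -> (j < p)%N -> l < circ_dist (e i) (e j).
  move=> ij jp; have p0 : (0 < p)%N by case: (p) jp.
  apply: lt_le_trans (_ : (2 ^+ p)^-1 <= _).
    by rewrite -[ltRHS]mul1r ltr_pdivlMr // mulrC lp.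
  apply: circ_dist_ge => m.
  have -> : r i - r j + m%:~R = (2 ^+ i - 2 ^+ j + m * 2 ^+ p)%:~R / 2 ^+ p.
    rewrite rmorphD rmorphB rmorphM !rmorphXn /= /r; field.
    by rewrite gt_eqF.
  rewrite normrM normfV (gtr0_norm P0).
  apply: ler_peMl; first by rewrite invr_ge0 ltW.
  rewrite norm_intr_ge1 ?intr_int // intr_eq0; apply/negP => /eqP mE.
  have ijE : (2 ^ i < 2 ^ j)%N by rewrite ltn_exp2l.
  have jpE : (2 ^ j < 2 ^ p)%N by rewrite ltn_exp2l.
  move: mE; rewrite -!natrX !natz => /small_multiple_eq0; lia.
have e_inj : {in `I_p &, injective e}.
  move=> i j; rewrite !inE /= => ip jp eij; case: (ltngtP i j) => // ij.
    by have := sep _ _ ij jp; rewrite eij circ_dist_xx ltNge l0.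
  by have := sep _ _ ij ip; rewrite eij circ_dist_xx ltNge l0.
split.
  exists (e @` `I_p); split; last exact: inj_card_eq.
  split=> [_ _ [i /= ip <-] [j /= jp <-] eij|x].
    case: (ltngtP i j) => [ij|ij|ij]; first exact: sep.
      by rewrite circ_dist_sym; exact: sep.
    by rewrite ij in eij.
  (* [c / 2 ^ p] is a multiple of [2 ^- p] nearest to [a], at distance at most [2^-1 / 2 ^ p <= l];
     reducing [c] modulo [2 ^ p] drops whole turns. *)
  pose a := repr x; pose c := Num.floor (2 ^+ p * a + 2^-1).
  pose d := `|(c %% (2 ^ p)%:Z)%Z|%N.
  have P0n : (2 ^ p)%:Z != 0 by rewrite eqz_nat expn_eq0.
  have dE : d%:Z = (c %% (2 ^ p)%:Z)%Z by rewrite /d gez0_abs // modz_ge0.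
  have [B BE] : exists B : {set 'I_p}, d = (\sum_(i in B) 2 ^ i)%N.
    by apply: binary_expansion; rewrite -ltz_nat dE ltz_mod.
  exists [fset e i | i : 'I_p in B]%fset; split.
    by move=> _ /= /imfsetP[i _ ->]; exists i => //=.
  rewrite (@sum_imfset _ _ (e \o val)) /=; last first.
    by move=> i j /e_inj ij; apply: val_inj; apply: ij; rewrite inE /=.
  rewrite -pi_RmodZ_sum.
  have -> : \pi_(RmodZ R) (\sum_(i in B) r i) = \pi_(RmodZ R) (c%:~R / 2 ^+ p).
    apply/pi_RmodZ_eqP; rewrite -mulr_suml.
    have -> : \sum_(i in B) 2 ^+ i = d%:Z%:~R :> R.
      by rewrite BE -pmulrn natr_sum; apply: eq_bigr => i _; rewrite natrX.
    have -> : c%:~R = (c %/ (2 ^ p)%:Z)%Z%:~R * 2 ^+ p + d%:Z%:~R :> R.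
      rewrite dE {1}(divz_eq c (2 ^ p)%:Z) rmorphD rmorphM.
      by congr (_ * _ + _); rewrite -natrX.
    rewrite -mulrBl opprD addrCA subrr addr0 mulNr mulfK ?gt_eqF //.
    by rewrite rpredN intr_int.
  rewrite -[x]reprK; apply: le_trans (circ_dist_le _ _) _.
  have /andP[] := floor_itv (2 ^+ p * a + 2^-1); rewrite -/c rmorphD /= => c1 c2.
  rewrite -(ler_pM2l P0) -[X in X * `|_|](gtr0_norm P0) -normrM.
  apply: le_trans pl; rewrite mulrBr mulrCA mulfV ?gt_eqF // mulr1 -/a.
  by rewrite ler_norml; apply/andP; split; lra.
move=> n F [_ Fgen] Fn; case: (posnP p) => [->//|/lp {}lp].
have [S SE FS] := subset_sums_seq Fn.
rewrite leqNgt; apply/negP => np.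
(* [arcs_cover_ge1] takes open arcs. The midpoint radius makes the covering strict yet stays below
   [2 ^- p], so for [n < p] the total length is still below 1. *)
have /andP[ll' l'P] : l < (l + 2 ^- p) / 2 < 2 ^- p.
  have : l < 2 ^- p by rewrite -[ltRHS]mul1r ltr_pdivlMr // mulrC.
  by move=> ?; apply/andP; split; lra.
have : 1 <= 2 * ((l + 2 ^- p) / 2) * (size S)%:R.
  apply: arcs_cover_ge1 => x; have [Z [ZF xZ]] := Fgen x.
  by exists (\sum_(g <- Z) g); [exact: FS|exact: le_lt_trans ll'].
apply/negP; rewrite -ltNge SE natrX mulrAC -exprS.
apply: (@lt_le_trans _ _ (2 ^+ n.+1 * 2 ^- p)).
  by rewrite ltr_pM2l ?exprn_gt0.
by rewrite ler_pdivrMr // mul1r ler_eXn2l ?ltr1n.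
Qed.

End Circle.

(** * Intervals of integers and the dimension of [H0] *)

(** The extremes are the sums of the negative and of the positive elements; checking these two
    replaces checking every subset. *)
Lemma subset_sum_bounds (Z Z' : {fset int}) : (Z' `<=` Z)%fset ->
  \sum_(g <- Z) Num.min g 0 <= \sum_(g <- Z') g <= \sum_(g <- Z) Num.max g 0.
Proof.
move=> ZZ'; have -> : \sum_(g <- Z') g = \sum_(g <- Z) if g \in Z' then g else 0.
  rewrite -big_mkcond [RHS]big_fset_condE; apply: eq_fbigl => g.
  rewrite !inE; case gZ': (g \in Z'); rewrite ?andbF //.
  by rewrite (fsubsetP ZZ').
by apply/andP; split; apply: ler_sum => g _; case: ifP => _; lia.
Qed.

Lemma dimS_int_itv (X : {pred int}) (X0 : 0 \in X) (N k : nat) :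
  (forall x, (x \in X) = (- N%:Z <= x <= N%:Z)) -> (2 ^ k <= N < 2 ^ k.+1)%N ->
  is_dimS (discrete (EMsub X0)) k.+2.
Proof.
move=> XE /andP[kN Nk]; apply/is_dimS_EMsubP.
have N0 : (0 < N)%N by apply: leq_trans kN; rewrite expn_gt0.
pose e i : int := if (i < k.+1)%N then (2 ^ i)%:Z else - N%:Z.
have e_inj : {in `I_k.+2 &, injective e}.
  have pN i : (2 ^ i)%:Z <> - N%:Z by have := expn_gt0 2 i; lia.
  move=> i j; rewrite !inE /= /e => ik jk.
  case: ifPn => ik'; case: ifPn => jk'; last by move=> _; lia.
  - by case=> /eqP; rewrite eqn_exp2l // => /eqP.
  - by move/pN.
  - by move/esym/pN.
have pos (x : nat) : (x <= N)%N -> exists P : {fset int},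
    [/\ [set` P] `<=` e @` `I_k.+2, forall g, g \in P -> 0 <= g
      & \sum_(g <- P) g = x%:Z].
  move=> xN; have [B BE] := binary_expansion (leq_ltn_trans xN Nk).
  exists [fset e i | i : 'I_k.+1 in B]%fset; split.
  - by move=> _ /= /imfsetP[i _ ->]; exists i => //=; exact: (leqW (ltn_ord i)).
  - by move=> _ /imfsetP[i _ ->]; rewrite /e ltn_ord.
  - rewrite (@sum_imfset _ _ (e \o val)) /=; last first.
      move=> i j /e_inj ij; apply: val_inj.
      by apply: ij; rewrite inE /=; exact: (leqW (ltn_ord _)).
    rewrite BE -[RHS]natz natr_sum; apply: eq_bigr => i _.
    by rewrite /e ltn_ord natz.
split.
  exists (e @` `I_k.+2); split; last exact: inj_card_eq.
  split=> [_ [i /= ik <-]|x].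
    rewrite XE /e; case: ifPn => ik'; last by lia.
    have : (2 ^ i <= 2 ^ k)%N by rewrite leq_exp2l.
    by lia.
  rewrite XE => /andP[xN Nx]; have [x0|x0] := leP 0 x.
    (* All summands are nonnegative, so partial sums lie between 0 and [x]. *)
    have [|P [Pe P0 Px]] := pos `|x|%N; first by lia.
    exists P; split=> // [|Z' /subset_sum_bounds]; first by rewrite Px; lia.
    rewrite XE (@eq_big_seq _ _ _ _ _ _ (fun=> 0)); last first.
      by move=> g /P0 g0; lia.
    rewrite big1 // (@eq_big_seq _ _ _ _ _ (fun g => Num.max g 0) id); last first.
      by move=> g /P0 g0; lia.
    by rewrite Px; move: (\sum_(g <- Z') g) => y; lia.
  (* Once [- N] is added to [P], partial sums lie between [- N] and [N + x < N]. *)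
  have [|P [Pe P0 Px]] := pos `|(x + N%:Z)%R|%N; first by lia.
  have NP : - N%:Z \notin P by apply/negP => /P0; lia.
  exists (- N%:Z |` P)%fset; split=> [g /=||Z' /subset_sum_bounds].
  - rewrite !inE => /orP[/eqP ->|/Pe //].
    by exists k.+1 => //=; rewrite /e ltnn.
  - by rewrite big_fsetU1 //= Px; lia.
  - rewrite XE !big_fsetU1 //= (@eq_big_seq _ _ _ _ _ _ (fun=> 0)); last first.
      by move=> g /P0 g0; lia.
    rewrite big1 // (@eq_big_seq _ _ _ _ _ (fun g => Num.max g 0) id); last first.
      by move=> g /P0 g0; lia.
    by rewrite Px; move: (\sum_(g <- Z') g) => y; lia.
move=> n F [_ Fgen] Fn; have [S SE FS] := subset_sums_seq Fn.
have sub : {subset [seq i%:Z - N%:Z | i <- iota 0 N.*2.+1] <= S}.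
  move=> z /mapP[i]; rewrite mem_iota /= add0n => iN ->.
  have [|Z [ZF <- _]] := Fgen (i%:Z - N%:Z); first by rewrite XE; lia.
  exact: FS.
have sh_inj : injective (fun i : nat => i%:Z - N%:Z) by move=> i j; lia.
have := uniq_leq_size _ sub; rewrite (map_inj_uniq sh_inj) iota_uniq => /(_ isT).
rewrite size_map size_iota SE => Nn.
(* [2 ^ k.+1 <= 2 N < 2 ^ n]: the strict inequality forces the last generator. *)
by rewrite -(ltn_exp2l _ _ (isT : (1 < 2)%N)) expnS; lia.
Qed.

Lemma dimS_EMsub0 (A : zmodType) (X : {pred A}) (X0 : 0 \in X) :
  (forall x, x \in X -> x = 0) -> is_dimS (discrete (EMsub X0)) 0.
Proof.
move=> XE; apply/is_dimS_EMsubP; split=> //; exists set0; split; last by rewrite II0.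
split=> // x /XE ->; exists fset0; split=> [g /=||Z'].
- by rewrite inE.
- by rewrite big_seq_fset0.
- by rewrite fsubset0 => /eqP ->; rewrite big_seq_fset0.
Qed.

(** * The two signs of [deg2 D] *)

Lemma lambda_powR (R : realType) (D : arakelov_divisor R) : lambda D = 2 `^ deg2 D.
Proof.
rewrite /powR pnatr_eq0 /= /deg2 divfK //.
by rewrite gt_eqF // ln_gt0 // ltr1n.
Qed.

Theorem theorem5p1 (R : realType) (D : arakelov_divisor R) :
  exists n0 n1 : nat,
    [/\ is_dimS (H0 D) n0,
        is_dimS (H1 D) n1
      & n0%:Z - n1%:Z = ceil' (deg2 D) + 1].
Proof.
have /andP[] := floor_itv (deg2 D); set t := Num.floor _ => t1 t2.
have : 2 ^ t <= lambda D < 2 ^ (t + 1).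
  rewrite lambda_powR -!powR_intmul //; apply/andP; split.
    by rewrite ler_powR // ler1n.
  by rewrite /powR pnatr_eq0 /= ltr_expR ltr_pM2r // ln_gt0 // ltr1n.
rewrite /ceil' -floor_ge0 -/t.
case: t {t1 t2} => [k|p].
  rewrite -PoszD addn1 -!exprnP => /andP[lk lk1].
  exists k.+2, 0%N; split; last by rewrite /=; lia.
  - apply: (@dimS_int_itv _ _ (Num.truncn (lambda D))) => [x|].
      rewrite unfold_in -ler_norml -intr_norm -ler_norml.
      by rewrite -abszE lez_nat truncn_ge_nat ?lambda_ge0.
    by rewrite truncn_ge_nat ?truncn_lt_nat ?lambda_ge0 // !natrX lk.
  - apply: dimS_U1 => //; rewrite expr0 mul1r; apply: le_trans lk.
    apply: (@le_trans _ _ 1); first by rewrite invf_le1 // ler1n.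
    by rewrite exprn_ege1 // ler1n.
(* [Negz p] is [- (p + 1)], so [lambda D] lies in [[2^-(p+1), 2^-p)], and the [+ 1] of the formula
   turns the floor into [- p]. *)
have -> : Negz p + 1 = - p%:Z by lia.
rewrite NegzE -!exprnN => /andP[lp1 lp].
have P0 : (0 : R) < 2 ^+ p by rewrite exprn_gt0.
have {}lp : 2 ^+ p * lambda D < 1 by rewrite mulrC -ltr_pdivlMr // mul1r.
exists 0%N, p; split; last by rewrite /=; lia.
- apply: dimS_EMsub0 => x; rewrite unfold_in -ler_norml -intr_norm => xl.
  have : (`|x|%:~R : R) < 1%:~R.
    apply: le_lt_trans xl _; apply: le_lt_trans lp.
    by rewrite ler_peMl ?lambda_ge0 // exprn_ege1 // ler1n.
  by rewrite ltr_int; lia.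
- apply: dimS_U1 => //.
  by rewrite mulrC -ler_pdivrMr // -invfM -exprS.
Qed.
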